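(* Let $G$ be a connected graph of order $n\ge 14$. If $\binom{n-3}{2}+4\le |E(G)|\le \binom{n}{2}-1$, then $pc(G)=2$.
   Context: All graphs are finite and simple. In an edge-colored graph (adjacent edges may have the same color), a path is proper if no two adjacent edges of the path have the same color. An edge-coloring of a connected graph $G$ is a proper-path coloring if every two distinct vertices of $G$ are connected by a proper path. The proper connection number $pc(G)$ is the smallest number of colors in a proper-path coloring of $G$. *)

(* Defs.v *)
From mathcomp Require Import all_boot.

Set Implicit Arguments.
Unset Strict Implicit.
Unset Printing Implicit Defensive.

Record sgraph := SGraph {
  vertex :> finType;
  adj : rel vertex;
  adj_sym : symmetric adj;
  adj_irrefl : irreflexive adj }.

Section ProperConnection.
Variable G : sgraph.

Definition edges : {set {set G}} :=
  [set [set x; y] | x in G, y in G & adj x y].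

Definition connected_graph : Prop := forall x y : G, connect (@adj G) x y.

Definition graph_path (x y : G) (p : seq G) : bool :=
  [&& path (@adj G) x p, last x p == y & uniq (x :: p)].

(* An edge-coloring is given by a function on all vertex sets; only its values
   on [edges] are ever used. *)
Definition edge_coloring := {set G} -> nat.

Definition path_colors (c : edge_coloring) (x : G) (p : seq G) : seq nat :=
  pairmap (fun u v => c [set u; v]) x p.

(* Two edges of a path are adjacent exactly when they are consecutive. *)
Definition proper_path (c : edge_coloring) (x y : G) (p : seq G) : bool :=
  graph_path x y p && sorted (fun a b => a != b) (path_colors c x p).

Definition proper_path_coloring (c : edge_coloring) : Prop :=
  forall x y : G, x != y -> exists p : seq G, proper_path c x y p.

Definition num_colors (c : edge_coloring) : nat :=
  size (undup [seq c f | f in edges]).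

(* [is_pc k] means pc(G) = k. *)
Definition is_pc (k : nat) : Prop :=
  (exists2 c, proper_path_coloring c & num_colors c = k) /\
  (forall c, proper_path_coloring c -> k <= num_colors c).

End ProperConnection.

(* Main.v *)
(** A proper 2-colouring of a bipartite graph amounts to an orientation: give
    an arc from [u] to [v] the colour of the side of [u]; then the
    properly coloured paths are exactly the directed paths, read in either
    direction. Hence [pc G <= 2] as soon as some spanning bipartite
    subgraph has an orientation in which of any two vertices one is
    reachable from the other.

    A strongly connected such orientation of a vertex set [U] extends to a
    vertex with two neighbours on the same side of [U] (in particular to
    any vertex with three neighbours in [U]), and along an ear of length
    three that respects the sides. As [G] misses at most [3n - 10] edges,
    it contains a [K_{2,3}], and an orientable [U] of at least five
    vertices that cannot be extended leaves out at most three vertices.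
    These are appended as two directed paths, one leading into [U] and one
    out of it. The only obstructions occur with three vertices left out;
    then [U] lacks at most two edges and one outer vertex has two
    neighbours in [U], so a new bipartition of [U], putting these two on
    the same side, yields a larger strongly orientable set. *)

Require Import Defs.
From mathcomp Require Import all_boot.
From mathcomp Require Import zify.

Set Implicit Arguments.
Unset Strict Implicit.
Unset Printing Implicit Defensive.

(** * Orientations of bipartite subgraphs and their extension by ears *)

Section Orientations.

Variable G : sgraph.
Implicit Types (V : {set G}) (f : G -> bool) (r : rel G).

(* [f] gives the bipartition; [r] may use only some of the edges inside [V]. *)
Definition oriented V f r := forall u v, r u v ->
  [/\ u \in V, v \in V, adj u v, f u != f v & ~~ r v u].

Definition strong_by V f r :=
  oriented V f r /\ {in V &, forall u v, connect r u v}.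

Definition strong V := exists f r, strong_by V f r.

(** Unilateral connectivity with marked ends: as everything is reachable from [s] and reaches [t],
    paths can still be attached at both ends. *)
Definition traversable V s t := exists f r,
  [/\ oriented V f r, s \in V, t \in V,
      {in V, forall u, connect r s u && connect r u t} &
      {in V &, forall u v, connect r u v || connect r v u}].

Definition add_arcs r (arcs : seq (G * G)) : rel G :=
  fun u v => r u v || ((u, v) \in arcs).

Lemma connect_add_arcs r arcs u v :
  connect r u v -> connect (add_arcs r arcs) u v.
Proof.
by apply: connect_sub => x y rxy; apply: connect1; rewrite /add_arcs rxy.
Qed.

Lemma connect_arc r arcs u v :
  (u, v) \in arcs -> connect (add_arcs r arcs) u v.
Proof. by move=> uv; apply: connect1; rewrite /add_arcs uv orbT. Qed.

(** A new arc has an end outside [V], so it cannot reverse an arc of [r]; new arcs need only be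
    compared with each other. *)
Lemma oriented_add_arcs V V' f f' r arcs :
    oriented V f r -> V \subset V' -> {in V, f' =1 f} ->
    (forall u v, (u, v) \in arcs ->
      [/\ (u \in V') && (v \in V'), ~~ ((u \in V) && (v \in V)), adj u v,
          f' u != f' v & (v, u) \notin arcs]) ->
  oriented V' f' (add_arcs r arcs).
Proof.
move=> oVr /subsetP sVV' ff' arcsP u v /orP[ruv|uv].
  have [uV vV auv fuv rvu] := oVr _ _ ruv.
  split; rewrite ?sVV' ?ff' // negb_or rvu /=.
  by apply/negP => /arcsP[_]; rewrite uV vV.
have [/andP[uV vV] uvV auv fuv vu] := arcsP _ _ uv.
split=> //; rewrite negb_or vu andbT.
by apply: contra uvV => /oVr[-> ->].
Qed.

Lemma strong_add_arcs V V' f f' r arcs :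
    strong_by V f r -> V \subset V' -> oriented V' f' (add_arcs r arcs) ->
    (forall x, x \in V' -> x \notin V ->
       (exists2 a, a \in V & connect (add_arcs r arcs) x a) /\
       (exists2 b, b \in V & connect (add_arcs r arcs) b x)) ->
  strong_by V' f' (add_arcs r arcs).
Proof.
move=> [oVr cVr] sVV' oV' ext; split=> // u v uV' vV'.
have [a aV ua] : exists2 a, a \in V & connect (add_arcs r arcs) u a.
  by have [uV|/(ext _ uV')[]//] := boolP (u \in V); exists u.
have [b bV bv] : exists2 b, b \in V & connect (add_arcs r arcs) b v.
  by have [vV|/(ext _ vV')[]//] := boolP (v \in V); exists v.
apply: connect_trans ua (connect_trans _ bv).
exact/connect_add_arcs/cVr.
Qed.

(** The ear [b -> x -> a], with [x] placed on the side opposite to [a] and [b]. *)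
Lemma strong_add_vertex V f r x a b :
    strong_by V f r -> x \notin V -> a \in V -> b \in V -> a != b ->
    adj x a -> adj x b -> f a = f b ->
  strong (x |: V).
Proof.
move=> sV xV aV bV ab xa xb fab.
pose f' v := if v == x then ~~ f a else f v.
have ff' : {in V, f' =1 f}.
  by move=> v vV; rewrite /f'; case: eqP => // vx; rewrite -vx vV in xV.
have f'x : f' x = ~~ f a by rewrite /f' eqxx.
pose arcs := [:: (b, x); (x, a)].
have xa' : x != a by apply: contraNneq xV => ->.
have xb' : x != b by apply: contraNneq xV => ->.
exists f', (add_arcs r arcs); apply: (strong_add_arcs sV).
- exact: subsetUr.
- apply: (oriented_add_arcs (proj1 sV) (subsetUr _ _) ff') => u v.
  rewrite !inE !xpair_eqE => /orP[]/andP[/eqP-> /eqP->]; split.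
  + by rewrite bV eqxx orbT.
  + by rewrite (negPf xV) andbF.
  + by rewrite adj_sym.
  + by rewrite f'x ff' // fab; case: (f b).
  + by rewrite (negPf xb') (eq_sym b a) (negPf ab) andbF.
  + by rewrite aV eqxx orbT.
  + by rewrite (negPf xV).
  + by [].
  + by rewrite f'x ff' //; case: (f a).
  + by rewrite (negPf ab) eq_sym (negPf xa').
- move=> v; rewrite !inE => /orP[/eqP-> _|->//]; split.
  + by exists a => //; apply: connect_arc; rewrite !inE eqxx orbT.
  + by exists b => //; apply: connect_arc; rewrite !inE eqxx.
Qed.

(** The ear [b -> y -> x -> a]; its sides can alternate because [a] and [b] lie on opposite
    sides. *)
Lemma strong_add_edge V f r x y a b :
    strong_by V f r -> x \notin V -> y \notin V -> a \in V -> b \in V ->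
    adj x y -> adj x a -> adj y b -> f a != f b ->
  strong (x |: (y |: V)).
Proof.
move=> sV xV yV aV bV xy xa yb fab.
have xy' : x != y by apply: contraTneq xy => ->; rewrite adj_irrefl.
have neqV z v : z \notin V -> v \in V -> (z == v) = false.
  by move=> zV vV; apply: contraNF zV => /eqP->.
pose f' v := if v == x then ~~ f a else if v == y then f a else f v.
have ff' : {in V, f' =1 f}.
  by move=> v vV; rewrite /f' eq_sym neqV // eq_sym neqV.
have f'x : f' x = ~~ f a by rewrite /f' eqxx.
have f'y : f' y = f a by rewrite /f' eq_sym (negPf xy') eqxx.
pose arcs := [:: (b, y); (y, x); (x, a)].
have sub : V \subset x |: (y |: V).
  by apply: subset_trans (subsetUr _ _) (subsetUr _ _).
have ya : connect (add_arcs r arcs) y x.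
  by apply: connect_arc; rewrite !inE eqxx ?orbT.
have yb' : connect (add_arcs r arcs) b y.
  by apply: connect_arc; rewrite !inE eqxx ?orbT.
have xa' : connect (add_arcs r arcs) x a.
  by apply: connect_arc; rewrite !inE eqxx ?orbT.
exists f', (add_arcs r arcs); apply: (strong_add_arcs sV sub).
- apply: (oriented_add_arcs (proj1 sV) sub ff') => u v.
  have [yx' ax bx] : [/\ y == x = false, a == x = false & b == x = false].
    by rewrite eq_sym (negPf xy') !(eq_sym _ x) !neqV.
  have [xaF yaF xbF ybF] :
      [/\ x == a = false, y == a = false, x == b = false & y == b = false].
    by rewrite !neqV.
  have [ay by'] : a == y = false /\ b == y = false.
    by rewrite !(eq_sym _ y) !neqV.
  rewrite !inE !xpair_eqE => /or3P[]/andP[/eqP-> /eqP->];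
    rewrite ?eqxx ?aV ?bV ?(negPf xV) ?(negPf yV) ?f'x ?f'y ?ff' ?orbT //=;
    rewrite ?yx' ?ax ?bx ?ay ?by' ?(negPf xy') ?xaF ?yaF ?xbF ?ybF ?andbF //;
    split=> //; rewrite 1?adj_sym //.
  + by rewrite eq_sym.
  + by case: (f a).
  + by case: (f a).
- move=> v; rewrite !inE => /or3P[/eqP-> _|/eqP-> _|->//]; split.
  + by exists a.
  + by exists b => //; apply: connect_trans yb' ya.
  + by exists a => //; apply: connect_trans ya xa'.
  + by exists b.
Qed.

(** The directed cycles [a -> y1 -> b -> y -> a], one for each [y] in [Y] other than [y1], share the
    path from [a] to [b]; [y2] guarantees that there is one. *)
Lemma strong_K2 (a b : G) (Y : {set G}) :
    a != b -> 1 < #|Y| -> {in Y, forall y, adj a y && adj b y} ->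
  strong (a |: (b |: Y)).
Proof.
move=> ab /card_gt1P[y1 [y2 [y1Y y2Y y12]]] abY.
have aY : a \notin Y.
  by apply/negP => /abY; rewrite adj_irrefl.
have bY : b \notin Y.
  by apply/negP => /abY; rewrite adj_irrefl andbF.
have neqY z v : z \notin Y -> v \in Y -> (z == v) = false.
  by move=> zV vV; apply: contraNF zV => /eqP->.
pose f (v : G) := v \in Y.
pose r (u v : G) := [|| (u == a) && (v == y1), (u == y1) && (v == b),
   [&& u == b, v \in Y & v != y1] | [&& v == a, u \in Y & u != y1]].
have ba : (b == a) = false by rewrite eq_sym (negPf ab).
have ya y : y \in Y -> (y == a) = false by rewrite eq_sym; apply: neqY.
have yb y : y \in Y -> (y == b) = false by rewrite eq_sym; apply: neqY.
have from_a v : v \in a |: (b |: Y) -> connect r a v.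
  have a1 : connect r a y1 by apply: connect1; rewrite /r !eqxx.
  have a2 : connect r a b.
    by apply: connect_trans a1 _; apply: connect1; rewrite /r !eqxx orbT.
  rewrite !inE => /or3P[/eqP->//|/eqP->//|vY].
  have [->//|v1] := eqVneq v y1.
  by apply: connect_trans a2 _; apply: connect1; rewrite /r eqxx vY v1 !orbT.
have to_a v : v \in a |: (b |: Y) -> connect r v a.
  have a2 : connect r y2 a.
    by apply: connect1; rewrite /r eqxx y2Y (eq_sym y2 y1) y12 !orbT.
  have ba' : connect r b a.
    apply: connect_trans a2; apply: connect1.
    by rewrite /r eqxx y2Y (eq_sym y2 y1) y12 !orbT.
  rewrite !inE => /or3P[/eqP->//|/eqP->//|vY].
  have [->|v1] := eqVneq v y1.
    by apply: connect_trans ba'; apply: connect1; rewrite /r !eqxx orbT.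
  by apply: connect1; rewrite /r eqxx vY v1 !orbT.
exists f, r; split; last first.
  by move=> u v uV vV; apply: connect_trans (to_a _ uV) (from_a _ vV).
have adjY y : y \in Y -> [/\ adj a y, adj b y, adj y a & adj y b].
  by move=> yY; rewrite !(adj_sym y); case/andP: (abY _ yY).
move=> u v; rewrite {1}/r /f !inE => /or4P[].
- case/andP=> /eqP-> /eqP->; have [] := adjY _ y1Y.
  rewrite /r !eqxx y1Y (negPf aY) (ya _ y1Y) (negPf ab) (yb _ y1Y).
  by rewrite (neqY _ _ aY y1Y) /= ?orbT.
- case/andP=> /eqP-> /eqP->; have [] := adjY _ y1Y.
  rewrite /r !eqxx y1Y (negPf bY) (ya _ y1Y) ba (yb _ y1Y).
  by rewrite (neqY _ _ bY y1Y) /= ?orbT.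
- case/and3P=> /eqP-> vY v1; have [] := adjY _ vY.
  rewrite /r !eqxx vY (negPf bY) (ya _ vY) ba (yb _ vY) (negPf v1).
  by rewrite ?(neqY _ _ bY vY) ?(neqY _ _ bY y1Y) /= ?orbT ?andbF.
- case/and3P=> /eqP-> vY v1; have [] := adjY _ vY.
  rewrite /r !eqxx vY (negPf aY) (ya _ vY) (negPf ab) (yb _ vY) (negPf v1) /=.
  by rewrite ?(neqY _ _ aY vY) ?(neqY _ _ aY y1Y) /= ?orbT ?andbF.
Qed.

(** * Attaching directed paths at the two ends *)

Lemma strong_traversable V s t :
  strong V -> s \in V -> t \in V -> traversable V s t.
Proof.
case=> f [r [oVr cVr]] sV tV; exists f, r; split=> // [u uV|u v uV vV].
  by rewrite !cVr.
by rewrite cVr.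
Qed.

Lemma traversable_rev V s t : traversable V s t -> traversable V t s.
Proof.
case=> f [r [oVr sV tV st uni]]; exists f, (fun u v => r v u); split=> //.
- move=> u v /oVr[uV vV uv fuv vu].
  by split=> //; rewrite 1?adj_sym // eq_sym.
- by move=> u /st; rewrite !(connect_rev r) /= andbC.
- by move=> u v uV vV; rewrite !(connect_rev r) /= uni.
Qed.

(** With the arc [t -> x], all of [V] reaches [x], which becomes the new end. *)
Lemma traversable_end V s t x :
  traversable V s t -> x \notin V -> adj t x -> traversable (x |: V) s x.
Proof.
case=> f [r [oVr sV tV st uni]] xV tx.
pose f' v := if v == x then ~~ f t else f v.
have ff' : {in V, f' =1 f}.
  by move=> v vV; rewrite /f'; case: eqP => // vx; rewrite -vx vV in xV.
have f'x : f' x = ~~ f t by rewrite /f' eqxx.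
pose r' := add_arcs r [:: (t, x)].
have cx u : u \in x |: V -> connect r' u x.
  rewrite !inE => /orP[/eqP->//|/st/andP[_ ut]].
  apply: connect_trans (connect_add_arcs _ ut) _.
  by apply: connect_arc; rewrite inE eqxx.
exists f', r'; split.
- apply: (oriented_add_arcs oVr (subsetUr _ _) ff') => u v.
  rewrite !inE !xpair_eqE => /andP[/eqP-> /eqP->]; split=> //.
  + by rewrite tV eqxx orbT.
  + by rewrite (negPf xV) andbF.
  + by rewrite f'x ff' //; case: (f t).
  + by rewrite andbC; apply: contraNN xV => /andP[/eqP<-].
- by rewrite !inE sV orbT.
- by rewrite !inE eqxx.
- move=> u uV; rewrite (cx _ uV) andbT.
  move: uV; rewrite !inE => /orP[/eqP->|/st/andP[su _]].
    by apply: cx; rewrite !inE sV orbT.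
  exact: connect_add_arcs.
- move=> u v uV vV.
  have [/eqP-> | ux] := boolP (v == x); first by rewrite cx.
  have [/eqP-> | vx] := boolP (u == x); first by rewrite cx ?orbT.
  have {}uV : u \in V by move: uV; rewrite !inE (negPf vx).
  have {}vV : v \in V by move: vV; rewrite !inE (negPf ux).
  case/orP: (uni u v uV vV) => c; first by rewrite connect_add_arcs.
  by rewrite orbC connect_add_arcs.
Qed.

End Orientations.

(** * From orientations to colourings, and basic edge counts *)

Section Colorings.

Variable G : sgraph.
Implicit Types (V : {set G}) (f g : G -> bool) (r : rel G).

(** Every edge has the colour of the side of its tail, and sides alternate along a directed walk;
    the walk is shortened to a path. *)
Lemma proper_path_connect (c : edge_coloring G) (e : rel G) g x y :
    (forall u v, e u v -> [/\ adj u v, c [set u; v] = g u & g u != g v]) ->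
    connect e x y -> exists p, proper_path c x y p.
Proof.
move=> eP /connectP[p ep ->]; case: (shortenP ep) => {p ep} q eq uq _.
exists q; apply/andP; split.
  rewrite /graph_path uq eqxx !andbT; apply: (@sub_path _ e) => //.
  by move=> u v /eP[].
case: q eq {uq} => //= v q /andP[/eP[_ -> /negPf guv]].
elim: q x v guv => //= w q IHq x v guv /andP[/eP[_ -> /negPf gvw] ew].
by apply/andP; split; [case: (g x) (g v) guv => [] [] | apply: IHq ew].
Qed.

(** Edges are unordered sets, so the tail is recovered from [r]; a set carrying no arc gets colour
    0. *)
Definition arc_coloring f r : edge_coloring G := fun e =>
  [exists u, exists v, [&& e == [set u; v], r u v & f u]].

(** The set could also be read as an arc from [v] to [u], but [oriented] forbids opposite arcs. *)
Lemma arc_coloringE V f r u v :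
  oriented V f r -> r u v -> arc_coloring f r [set u; v] = f u.
Proof.
move=> oVr ruv; congr nat_of_bool; apply/existsP/idP => [[u' /existsP[v']]|fu].
  case/and3P=> /eqP euv ru'v' fu'.
  have: u' \in [set u; v] by rewrite euv set21.
  have: v' \in [set u; v] by rewrite euv set22.
  have [_ _ auv _ nrvu] := oVr _ _ ruv.
  have [_ _ au'v' fu'v' _] := oVr _ _ ru'v'.
  rewrite !inE => /orP[]/eqP ev /orP[]/eqP eu; subst u' v' => //.
    by rewrite ru'v' in nrvu.
  by rewrite adj_irrefl in au'v'.
by exists u; apply/existsP; exists v; rewrite eqxx ruv.
Qed.

Lemma traversable_proper f r :
    oriented setT f r -> (forall u v, connect r u v || connect r v u) ->
  proper_path_coloring (arc_coloring f r).
Proof.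
move=> oTr uni x y _; case/orP: (uni x y) => cxy.
  apply: proper_path_connect cxy => u v ruv.
  by have [_ _ auv fuv _] := oTr _ _ ruv; rewrite (arc_coloringE oTr ruv).
have {}cxy : connect (fun u v => r v u) x y by rewrite (connect_rev r).
(* Traversed backwards, an arc has the colour of the vertex entered, which is the negated side of
   the vertex left. *)
apply: (@proper_path_connect _ _ (fun v => ~~ f v)) cxy => u v rvu.
have [_ _ avu fvu _] := oTr _ _ rvu.
rewrite setUC (arc_coloringE oTr rvu) adj_sym avu.
by move: fvu; case: (f u) (f v) => [] [].
Qed.

Lemma num_colors_le2 (c : edge_coloring G) :
  (forall e, c e < 2) -> num_colors c <= 2.
Proof.
move=> c2; apply: (@uniq_leq_size _ _ [:: 0; 1]); first exact: undup_uniq.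
move=> k; rewrite mem_undup => /mapP[e _ ->].
by rewrite !inE; case: (c e) (c2 e) => [|[]].
Qed.

(** A proper path between non-adjacent vertices has at least two edges, and the first two differ in
    colour. *)
Lemma num_colors_ge2 (c : edge_coloring G) (x y : G) :
  x != y -> ~~ adj x y -> proper_path_coloring c -> 2 <= num_colors c.
Proof.
move=> xy nxy /(_ _ _ xy)[p /andP[/and3P[]]].
case: p => [|a [|b p]] /=; first by rewrite (negPf xy).
  by rewrite andbT => xa /eqP ya; rewrite -ya xa in nxy.
case/and3P=> xa ab _ _ _ /andP[cab _].
have edgeP u v : adj u v -> c [set u; v] \in undup [seq c e | e in edges G].
  move=> auv; rewrite mem_undup; apply/mapP; exists [set u; v] => //.
  by rewrite mem_enum; apply/imset2P; exists u v; rewrite ?inE.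
apply: (@uniq_leq_size _ [:: c [set x; a]; c [set a; b]]).
  by rewrite /= inE cab.
by move=> k; rewrite !inE => /orP[]/eqP->; apply: edgeP.
Qed.

Lemma traversable_pc2 (x y s t : G) :
  x != y -> ~~ adj x y -> traversable [set: G] s t -> is_pc G 2.
Proof.
move=> xy nxy [f [r [oTr _ _ _ uni]]].
have ge2 := num_colors_ge2 xy nxy.
have prop : proper_path_coloring (arc_coloring f r).
  by apply: traversable_proper oTr _ => u v; apply: uni.
split=> //; exists (arc_coloring f r) => //; apply/eqP.
rewrite eqn_leq ge2 // andbT; apply: num_colors_le2 => e.
by rewrite /arc_coloring; case: [exists u, _].
Qed.

Lemma edges_le_complete :
  (forall x y : G, x != y -> adj x y) -> 'C(#|G|, 2) <= #|edges G|.
Proof.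
move=> adjT; rewrite -[#|G|]cardsT -cards_draws; apply: subset_leq_card.
apply/subsetP => A; rewrite inE => /andP[_ /cards2P[x [y [xy ->]]]].
by apply/imset2P; exists x y; rewrite // inE adjT.
Qed.

(** Each edge comes from the two ordered pairs of its ends. *)
Lemma double_edges_le : #|edges G|.*2 <= \sum_(x : G) \sum_(y : G) adj x y.
Proof.
pose E (p : G * G) := [set p.1; p.2].
have -> : \sum_(x : G) \sum_(y : G) adj x y = \sum_(p : G * G | adj p.1 p.2) 1.
  rewrite pair_bigA [RHS]big_mkcond; apply: eq_bigr => p _.
  by case: (adj _ _).
rewrite (partition_big E (mem (edges G))) => [|[x y] xy]; last first.
  by apply/imset2P; exists x y; rewrite ?inE.
rewrite -muln2 -sum_nat_const; apply: leq_sum => e /imset2P[x y _].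
rewrite inE => /andP[_ xy] ->; rewrite sum1_card.
have nxy : x != y by apply: contraTneq xy => ->; rewrite adj_irrefl.
apply/card_gt1P; exists (x, y), (y, x).
split; rewrite ?unfold_in /E /= ?xpair_eqE ?(negPf nxy) //.
  by rewrite xy eqxx.
by rewrite adj_sym xy setUC eqxx.
Qed.

Lemma connected_exit V x y : connected_graph G -> x \in V -> y \notin V ->
  exists u v : G, [/\ u \in V, v \notin V & adj u v].
Proof.
move=> /(_ x y)/connectP[p]; elim: p x => [|z p IHp] x /=.
  by move=> _ -> ->.
move=> /andP[xz zp] yp xV yV; have [zV|zV] := boolP (z \in V).
  exact: IHp zp yp zV yV.
by exists x, z.
Qed.

End Colorings.

(** * Degrees, missing edges, and growth of strongly orientable sets *)

Section Degrees.

Variable G : sgraph.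
Implicit Types (U V Z : {set G}) (x y z : G).

Definition deg V x := \sum_(y in V) adj x y.
(** Summed over all vertices with [V = setT], this counts each missing edge twice. *)
Definition codeg V x := \sum_(y in V) ((x != y) && ~~ adj x y).

Lemma sum_card_set V (P : pred G) : \sum_(y in V) P y = #|[set y in V | P y]|.
Proof.
rewrite -sum1dep_card big_mkcondr /=; apply: eq_bigr => y _.
by case: (P y).
Qed.

Lemma deg_codeg V x : deg V x + codeg V x + (x \in V) = #|V|.
Proof.
rewrite /deg /codeg -big_split -sum1_card /=.
have -> : (x \in V : nat) = \sum_(y in V) (x == y).
  have [xV|xV] := boolP (x \in V).
    rewrite (bigD1 x) //= eqxx big1 ?addn0 // => y /andP[_].
    by rewrite eq_sym => /negPf->.
  by rewrite big1 // => y yV; case: eqP => // xy; rewrite xy yV in xV.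
rewrite -big_split; apply: eq_bigr => y _ /=.
by case: eqVneq => [<-|_]; rewrite ?adj_irrefl //; case: (adj x y).
Qed.

Lemma deg_sub V U x : V \subset U -> deg V x <= deg U x.
Proof.
move=> sVU; rewrite /deg [leqRHS](big_setID V) /= (setIidPr sVU).
exact: leq_addr.
Qed.

Lemma codeg_sub V U x : V \subset U -> codeg V x <= codeg U x.
Proof.
move=> sVU; rewrite /codeg [leqRHS](big_setID V) /= (setIidPr sVU).
exact: leq_addr.
Qed.

Lemma deg_gt0 V x : 0 < deg V x -> exists2 a, a \in V & adj x a.
Proof.
rewrite /deg sum_card_set => /card_gt0P[a].
by rewrite inE => /andP[aV xa]; exists a.
Qed.

Lemma deg_gt1 V x : 1 < deg V x ->
  exists a b, [/\ a \in V, b \in V, adj x a, adj x b & a != b].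
Proof.
rewrite /deg sum_card_set => /card_gt1P[a [b []]].
rewrite !inE => /andP[aV xa] /andP[bV xb] ab.
by exists a, b.
Qed.

(** Of three neighbours, two lie on the same side. *)
Lemma strong_add_deg3 V x :
  strong V -> x \notin V -> 2 < deg V x -> strong (x |: V).
Proof.
case=> f [r sV] xV; rewrite /deg sum_card_set => /card_gt2P[a [b [c []]]].
rewrite !inE => -[/andP[aV xa] /andP[bV xb] /andP[cV xc]] [ab bc ca].
have [fab|fab] := eqVneq (f a) (f b).
  exact: (strong_add_vertex sV xV aV bV).
have [fbc|fbc] := eqVneq (f b) (f c).
  exact: (strong_add_vertex sV xV bV cV).
apply: (strong_add_vertex sV xV cV aV) => //.
by move: fab fbc; case: (f a) (f b) (f c) => [] [] [].
Qed.

Lemma strong_add_all V Z :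
  strong V -> {in Z, forall z, 2 < deg V z} -> strong (V :|: Z).
Proof.
move=> sV; rewrite -[Z]set_enum.
elim: (enum Z) => [|z s IHs] degZ.
  by rewrite (_ : _ :|: _ = V) //; apply/setP => y; rewrite !inE orbF.
have {}IHs : strong (V :|: [set:: s]).
  by apply: IHs => y; rewrite inE => ys; apply: degZ; rewrite !inE ys orbT.
have -> : V :|: [set:: z :: s] = z |: (V :|: [set:: s]).
  by apply/setP => y; rewrite !inE orbCA.
have [zV|zV] := boolP (z \in V :|: [set:: s]).
  by rewrite (setUidPr _) // sub1set.
apply: strong_add_deg3 => //; apply: leq_trans (deg_sub _ (subsetUl _ _)).
by apply: degZ; rewrite !inE eqxx.
Qed.

(** Two neighbours of [x] on the same side allow adding [x] alone. Otherwise one of them is opposite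
    to a neighbour of [y], which gives an ear of length three. *)
Lemma strong_grow_edge V x y :
    strong V -> x \notin V -> y \notin V -> adj x y ->
    1 < deg V x -> 0 < deg V y ->
  exists2 V' : {set G}, strong V' & #|V| < #|V'|.
Proof.
case=> f [r sV] xV yV xy /deg_gt1[a1 [a2 [a1V a2V xa1 xa2 a12]]].
case/deg_gt0 => b bV yb.
have [fa|fa] := eqVneq (f a1) (f a2).
  exists (x |: V); last by rewrite cardsU1 xV.
  exact: (strong_add_vertex sV xV a1V a2V).
have xy' : x != y by apply: contraTneq xy => ->; rewrite adj_irrefl.
exists (x |: (y |: V)); last first.
  by rewrite !cardsU1 !inE (negPf xy') xV yV /= ltnS leqW.
have [fb|fb] := eqVneq (f a1) (f b); last first.
  exact: (strong_add_edge sV xV yV a1V bV).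
by apply: (strong_add_edge sV xV yV a2V bV); rewrite // -fb eq_sym.
Qed.

Lemma sum_codeg_split U :
  \sum_x codeg setT x = \sum_(x in U) codeg U x +
    2 * \sum_(x in ~: U) codeg U x + \sum_(x in ~: U) codeg (~: U) x.
Proof.
have split_codeg x : codeg setT x = codeg U x + codeg (~: U) x.
  by rewrite /codeg (big_setID U) setTI setTD.
have -> : \sum_x codeg setT x =
    \sum_(x in U) codeg setT x + \sum_(x in ~: U) codeg setT x.
  rewrite -(setTD U) -[in X in X + _](setTI U) -big_setID.
  by apply: eq_bigl => x; rewrite inE.
rewrite !(eq_bigr _ (fun x _ => split_codeg x)) !big_split /=.
have -> : \sum_(x in U) codeg (~: U) x = \sum_(x in ~: U) codeg U x.
  rewrite /codeg exchange_big; apply: eq_bigr => x _; apply: eq_bigr => y _ /=.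
  by rewrite eq_sym adj_sym.
lia.
Qed.

(** At most ['C(n, 2) - 'C(n - 3, 2) - 4 = 3n - 10] edges are missing, each counted twice. *)
Lemma sum_codeg_edges : 14 <= #|G| ->
    'C(#|G| - 3, 2) + 4 <= #|edges G| ->
  \sum_(x : G) codeg setT x + 20 <= 6 * #|G|.
Proof.
set n := #|G| => n14 low.
have := double_edges_le G.
have : \sum_(x : G) (deg setT x + codeg setT x + 1) = n * n.
  rewrite (eq_bigr (fun=> n)) ?sum_nat_const // => x _.
  by have := deg_codeg setT x; rewrite inE cardsT.
rewrite !big_split /= sum1_card -/n.
have -> : \sum_(x : G) \sum_y adj x y = \sum_(x : G) deg setT x.
  by apply: eq_bigr => x _; apply: eq_bigl => y; rewrite inE.
have := mul_bin_diag (n - 3) 1; rewrite bin1 => C2.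
move: low; rewrite -muln2; move: C2; set C := 'C(_, _).
set S := \sum_x deg _ _; set M := \sum_x codeg _ _; set E := #|_|.
have [m ->] : exists m, n = m + 3 by exists (n - 3); lia.
rewrite addnK; nia.
Qed.

(* If at most one vertex had fewer than [(n - 4) / 2] non-neighbours, there
   would be at least [(n - 1) (n - 4) / 4 > 3 n - 10] missing edges. *)
Lemma common_neighbours : 14 <= #|G| ->
    \sum_(x : G) codeg setT x + 20 <= 6 * #|G| ->
  exists a b : G, a != b /\ 2 < #|[set y | adj a y && adj b y]|.
Proof.
set n := #|G| => n14 dense.
(* Two members of [L] have at most [n - 5] non-neighbours in total; discarding also the two vertices
   themselves leaves three common neighbours. *)
pose L := [set x : G | codeg setT x * 2 + 5 <= n].
have /card_gt1P[a [b [aL bL ab]]] : 1 < #|L|.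
  rewrite ltnNge; apply/negP => L1.
  have : \sum_(x in ~: L) (n - 4) <= \sum_(x : G) codeg setT x * 2.
    rewrite [leqRHS](bigID (mem L)) /= -[leqLHS]add0n leq_add //.
    rewrite (eq_bigl (fun x => x \notin L)) => [|x]; last by rewrite inE.
    by apply: leq_sum => x; rewrite inE; lia.
  rewrite sum_nat_const -big_distrl /=; move: (cardsC L).
  rewrite -/n; move: dense; set M := \sum_x _.
  nia.
exists a, b; split=> //; rewrite !inE in aL bL.
have : n <= #|[set y | adj a y && adj b y]| + codeg setT a + codeg setT b + 2.
  have := deg_codeg setT a; have := deg_codeg setT b.
  rewrite !inE cardsT -/n /deg !sum_card_set.
  set A := [set y in _ | adj a y]; set B := [set y in _ | adj b y].
  have -> : [set y | adj a y && adj b y] = A :&: B.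
    by apply/setP => y; rewrite !inE.
  have := cardsUI A B; have : #|A :|: B| <= n by exact: max_card.
  lia.
lia.
Qed.

End Degrees.

(** * Strongly orientable sets that cannot grow *)

Section Spanning.

Variable G : sgraph.
Implicit Types (U V Z : {set G}) (x y z : G).

(** The extra 1 is [x] itself, which is not adjacent to itself. *)
Lemma codeg_complement U x :
  x \in U -> codeg U x + 1 = #|[set y in U | ~~ adj x y]|.
Proof.
move=> xU; have := deg_codeg U x; rewrite xU /deg sum_card_set.
have := cardsID [set y | adj x y] U.
have -> : U :&: [set y | adj x y] = [set y in U | adj x y].
  by apply/setP => y; rewrite !inE.
have -> : U :\: [set y | adj x y] = [set y in U | ~~ adj x y].
  by apply/setP => y; rewrite !inE andbC.
lia.
Qed.

(* Two neighbours [a], [b] of [x] and their common neighbours form a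
   [K_{2,m}] through [x]; all other vertices of [U] have at least three
   neighbours in it. *)
Lemma strong_almost_complete U x :
    9 < #|U| -> \sum_(y in U) codeg U y <= 4 -> x \notin U -> 1 < deg U x ->
  strong (x |: U).
Proof.
move=> U10 dense xU /deg_gt1[a [b [aU bU xa xb ab]]].
pose nadj y := [set z in U | ~~ adj y z].
(* As [nadj a] contains [a] and [nadj b] contains [b], neither lies in [Y]. *)
pose Y := x |: (U :\: (nadj a :|: nadj b)).
have setD_bound (A B : {set G}) : #|A| <= #|A :\: B| + #|B|.
  by rewrite -(cardsID B A) addnC leq_add2l subset_leq_card ?subsetIr.
have cover (A B : {set G}) : #|U| <= #|U :\: (A :|: B)| + #|A| + #|B|.
  rewrite -setDDl; have := setD_bound U A.
  by have := setD_bound (U :\: A) B; lia.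
have codegs y : y \in U -> y != a -> y != b ->
    codeg U a + codeg U b + codeg U y <= 4.
  move=> yU ya yb; apply: leq_trans dense.
  rewrite (bigD1 a) //= (bigD1 b) /= ?bU 1?eq_sym // (bigD1 y) ?yU ?ya //=.
  lia.
have codegab : codeg U a + codeg U b <= 4.
  apply: leq_trans dense.
  by rewrite (bigD1 a) //= (bigD1 b) /= ?bU 1?eq_sym // addnA leq_addr.
have Yadj : {in Y, forall y, adj a y && adj b y}.
  move=> y; rewrite !inE => /orP[/eqP->|/andP[+ yU]].
    by rewrite !(adj_sym _ x) xa.
  by rewrite yU /= negb_or !negbK.
have Y2 : 1 < #|Y|.
  rewrite cardsU1 !inE (negPf xU) andbF.
  have := cover (nadj a) (nadj b); rewrite -!codeg_complement //; lia.
have sV := strong_K2 ab Y2 Yadj; set V := a |: (b |: Y) in sV.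
have -> : x |: U = V :|: (U :\: V).
  apply/setP => y; rewrite !inE.
  have [->|ya] := eqVneq y a; first by rewrite aU orbT.
  have [->|yb] := eqVneq y b; first by rewrite bU !orbT.
  have [->|yx] := eqVneq y x; first by rewrite ?orbT.
  by case: (y \in U); rewrite ?andbF ?andbT ?orbN.
apply: strong_add_all sV _ => y; rewrite inE => /andP[yV yU].
have /andP[ya yb] : (y != a) && (y != b).
  by rewrite -negb_or; apply: contra yV; rewrite !inE orbA => ->.
rewrite /deg sum_card_set.
(* The set on the left has at least [10 - (4 + 3) = 3] elements: the three codegrees sum to at most
   4, and each [nadj] set also contains its own vertex. *)
have sub : U :\: (nadj a :|: nadj b) :\: nadj y \subset [set z in V | adj y z].
  apply/subsetP => z; rewrite !inE => /andP[+ /andP[+ zU]].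
  by rewrite zU /= negbK => -> ->; rewrite ?orbT.
apply: leq_trans (subset_leq_card sub).
have := cover (nadj a) (nadj b); have := codegs y yU ya yb.
have := setD_bound (U :\: (nadj a :|: nadj b)) (nadj y).
rewrite -!codeg_complement //; move: U10.
move: (codeg _ _) (codeg _ _) (codeg _ _) #|U| #|_| #|_|; clear; lia.
Qed.

(* [k = #|~: U|] vertices with [w] of degree 2 into [U] miss at least
   [k (#|U| - 1) - w + 'C(w, 2) >= k (#|U| - 1) - 1] edges. *)
Lemma outside_le3 U : 14 <= #|G| -> 4 < #|U| ->
    \sum_(x : G) codeg setT x + 20 <= 6 * #|G| ->
    (forall x, x \notin U -> deg U x <= 2) ->
    (forall x y, x \notin U -> y \notin U -> adj x y ->
       1 < deg U x -> 1 < deg U y -> false) ->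
  #|~: U| <= 3.
Proof.
move=> n14 u5; rewrite (sum_codeg_split U) => dense deg2 indep.
pose W2 := [set x in ~: U | 1 < deg U x].
have sW2 : W2 \subset ~: U by apply/subsetP => x; rewrite inE => /andP[].
have UW : #|~: U| * (#|U| - 1) <= \sum_(x in ~: U) codeg U x + #|W2|.
  rewrite -sum_card_set -big_split -sum_nat_const /=; apply: leq_sum => x.
  rewrite inE => xU; have := deg_codeg U x; rewrite (negPf xU).
  have := deg2 x xU; lia.
(* [W2] is independent, so each of its vertices misses all the others. *)
have WW : #|W2| * (#|W2| - 1) <= \sum_(x in ~: U) codeg (~: U) x.
  rewrite [leqRHS](big_setID W2) (setIidPr sW2) /= -[leqLHS]addn0 leq_add //.
  rewrite -sum_nat_const; apply: leq_sum => x xW2.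
  apply: leq_trans (codeg_sub _ sW2).
  have := deg_codeg W2 x; rewrite xW2.
  have -> : deg W2 x = 0; last lia.
  apply: big1 => y; move: xW2; rewrite !inE => /andP[xU x1] /andP[yU y1].
  by case xy: (adj x y) => //; have := indep x y xU yU xy x1 y1.
have nUW := cardsC U.
move: dense UW WW; set sU := \sum_(x in U) _.
set sUW := \sum_(x in ~: U) codeg U x.
set sWW := \sum_(x in _) codeg (~: U) x.
rewrite leqNgt; move: n14 u5; rewrite -nUW.
move: #|U| #|~: U| #|W2| => u k w n14 u5 dense UW WW.
apply/negP => k4.
have [k' ek] : exists k', k = k' + 4 by exists (k - 4); lia.
have [u' eu] : exists u', u = u' + 5 by exists (u - 5); lia.
subst k u.
have w2 : 2 * w <= 2 + w * (w - 1) by case: w {UW WW} => [|[|w]]; nia.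
(* With [k = k' + 4] and [u = u' + 5] this reads [(k - 3) (u - 4) <= 3], but these positive factors
   sum to [n - 7 >= 7], so their product is at least 6. *)
have : 2 * ((k' + 4) * (u' + 5 - 1)) <= 6 * (u' + 5 + (k' + 4)) - 18 by lia.
nia.
Qed.

Lemma traversable_start V s t x :
  traversable V s t -> x \notin V -> adj s x -> traversable (x |: V) x t.
Proof.
move=> /traversable_rev tV xV sx.
exact/traversable_rev/traversable_end/sx.
Qed.

Definition spanned := exists s t, traversable [set: G] s t.

(** * Exactly three vertices left out *)

Section ThreeLeft.

Variable U : {set G}.
Hypotheses (strongU : strong U) (card_out : #|~: U| = 3).

Lemma cover_out x y z :
    x \notin U -> y \notin U -> z \notin U -> x != y -> x != z -> y != z ->
  ~: U = [set x; y; z].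
Proof.
move=> xU yU zU xy xz yz; apply/eqP; rewrite eq_sym eqEcard card_out.
apply/andP; split.
  by apply/subsetP => v; rewrite !inE => /orP[/orP[]|] /eqP->.
by rewrite -setUA !cardsU1 cards1 !inE negb_or xy xz yz.
Qed.

Lemma cover_all x y z :
    x \notin U -> y \notin U -> z \notin U -> x != y -> x != z -> y != z ->
  z |: (y |: (x |: U)) = [set: G].
Proof.
move=> xU yU zU xy xz yz; apply/setP => v; have := cover_out xU yU zU xy xz yz.
move/setP/(_ v); rewrite !inE.
by case: (v == x) (v == y) (v == z) (v \in U) => [] [] [] [].
Qed.

Lemma spanned_path a x y z :
    x \notin U -> y \notin U -> z \notin U -> x != y -> x != z -> y != z ->
    a \in U -> adj a x -> adj x y -> adj y z ->
  spanned.
Proof.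
move=> xU yU zU xy xz yz aU ax xy' yz'.
have := strong_traversable strongU aU aU.
move=> /traversable_end/(_ xU ax).
move=> /(@traversable_end _ _ _ _ y)/[!inE]/[!negb_or]/[!(eq_sym y x)].
rewrite xy yU => /(_ isT xy').
move=> /(@traversable_end _ _ _ _ z)/[!inE]/[!negb_or]/[!(eq_sym z)].
by rewrite xz yz zU cover_all // => /(_ isT yz'); exists a, z.
Qed.

(** The path through [x] and [y] leads out of [U], while [z] leads into it. *)
Lemma spanned_two_paths a b x y z :
    x \notin U -> y \notin U -> z \notin U -> x != y -> x != z -> y != z ->
    a \in U -> b \in U -> adj a x -> adj x y -> adj b z ->
  spanned.
Proof.
move=> xU yU zU xy xz yz aU bU ax xy' bz.
have := strong_traversable strongU bU aU.
move=> /traversable_end/(_ xU ax).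
move=> /(@traversable_end _ _ _ _ y)/[!inE]/[!negb_or]/[!(eq_sym y x)].
rewrite xy yU => /(_ isT xy').
move=> /(@traversable_start _ _ _ z)/[!inE]/[!negb_or]/[!(eq_sym z)].
by rewrite xz yz zU cover_all // => /(_ isT bz); exists z, y.
Qed.

Hypothesis connG : connected_graph G.
Hypothesis dense : \sum_(x : G) codeg setT x + 20 <= 6 * #|G|.
Hypothesis deg_le2 : forall x, x \notin U -> deg U x <= 2.
Hypothesis U_gt0 : 0 < #|U|.

(** Connectivity attaches [x] to [U], then [y], then [z], each to something already reached. Each
    attachment pattern either yields the required paths or leaves too few outer edges, and then
    counting makes [U] almost complete. *)
Lemma three_left : spanned \/
  exists2 w, w \notin U & 1 < deg U w /\ \sum_(x in U) codeg U x <= 4.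
Proof.
have [s sU] := card_gt0P U_gt0.
have exit V : s \in V -> #|V| < #|G| ->
    exists u v, [/\ u \in V, v \notin V & adj u v].
  move=> sV VG; have /card_gt0P[t] : 0 < #|~: V| by rewrite cardsCs setCK; lia.
  by rewrite inE => tV; apply: (connected_exit connG sV tV).
have cardG : #|G| = #|U| + 3 by rewrite -(cardsC U) card_out.
have [a [x [aU xU ax]]] : exists u v, [/\ u \in U, v \notin U & adj u v].
  by apply: exit; rewrite // cardG; lia.
have cxU : #|x |: U| = #|U| + 1 by rewrite cardsU1 xU addnC.
have [u [y [uU]]] :
    exists u v, [/\ u \in x |: U, v \notin x |: U & adj u v].
  by apply: exit; rewrite ?inE ?sU ?orbT // cxU cardG; lia.
rewrite inE negb_or inE => /andP[yx yU] uy.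
have cyU : #|y |: (x |: U)| = #|U| + 2.
  by rewrite cardsU1 cxU !inE negb_or yx yU; lia.
have [v [z [vU]]] :
    exists u v, [/\ u \in y |: (x |: U), v \notin y |: (x |: U) & adj u v].
  by apply: exit; rewrite ?inE ?sU ?orbT // cyU cardG; lia.
rewrite !inE !negb_or => /and3P[zy zx zU] vz.
have [xy xz yz] : [/\ x != y, x != z & y != z] by rewrite !(eq_sym _ z) eq_sym.
have sum3 (F : G -> nat) : \sum_(w in ~: U) F w = F x + F y + F z.
  rewrite (cover_out xU yU zU xy xz yz) -setUA.
  by rewrite !big_setU1 ?big_set1 ?inE ?negb_or ?xy //= addnA.
(* This is [dense] with [codeg U w = #|U| - deg U w] for the outer vertices; the terms in [#|U|]
   cancel and [20 - 18 = 2] remains. *)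
have count : \sum_(w in U) codeg U w +
    2 * (~~ adj x y + ~~ adj x z + ~~ adj y z) + 2 <= 2 * (deg U x + deg U y + deg U z).
  move: dense; rewrite (sum_codeg_split U) !sum3 /codeg !sum3.
  rewrite !eqxx xy xz yz yx zx zy /= !(adj_sym z) !(adj_sym y x).
  have := deg_codeg U x; have := deg_codeg U y; have := deg_codeg U z.
  rewrite (negPf xU) (negPf yU) (negPf zU) /codeg cardG !addn0.
  clear; lia.
have [dx dy dz] : [/\ deg U x <= 2, deg U y <= 2 & deg U z <= 2].
  by rewrite !deg_le2.
(* With no outer edge, [count] gives a sum of at most [12 - 8 = 4] and total degree at least 4. If
   [y] and [z] have no neighbour in [U], [x] has two and the sum is 0. *)
have bad : ~~ adj y z -> (adj x y = false /\ adj x z = false) \/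
    (deg U y = 0 /\ deg U z = 0) ->
    exists2 w, w \notin U & 1 < deg U w /\ \sum_(x in U) codeg U x <= 4.
  move=> nyz hyp.
  have [S4 /or3P w1] : \sum_(w in U) codeg U w <= 4 /\
      [|| 1 < deg U x, 1 < deg U y | 1 < deg U z].
    move: count dx dy dz; rewrite nyz; case: hyp => [[-> ->]|[-> ->]];
      by clear; lia.
  by case: w1 => w1; [exists x | exists y | exists z].
move: uU vU; rewrite !inE => /orP[/eqP eu|uU] /or3P[/eqP ev|/eqP ev|vU];
  rewrite ?eu ?ev in uy vz.
- by left; apply: (spanned_path xU yU zU xy xz yz aU ax).
(* Both [y] and [z] hang on [x]: a path through all three exists unless they are non-adjacent and
   have no neighbour in [U]. *)
- have [/deg_gt0[b bU yb]|y0] := ltnP 0 (deg U y).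
    left; apply: (spanned_path yU xU zU yx yz xz bU) => //;
      by rewrite adj_sym.
  have [/deg_gt0[b bU zb]|z0] := ltnP 0 (deg U z).
    left; apply: (spanned_path zU xU yU zx zy xy bU) => //;
      by rewrite adj_sym.
  have [yz'|nyz] := boolP (adj y z).
    by left; apply: (spanned_path xU yU zU xy xz yz aU ax).
  by right; apply: bad => //; right; split; apply/eqP; rewrite -leqn0.
- by left; apply: (spanned_two_paths xU yU zU xy xz yz aU vU ax).
- by left; apply: (spanned_two_paths yU zU xU yz yx zx uU aU uy).
- by left; apply: (spanned_two_paths xU zU yU xz xy zy aU uU ax).
(* All three have neighbours in [U], so any edge among them suffices. *)
- have [xy'|nxy] := boolP (adj x y).
    by left; apply: (spanned_two_paths xU yU zU xy xz yz aU vU ax).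
  have [xz'|nxz] := boolP (adj x z).
    by left; apply: (spanned_two_paths xU zU yU xz xy zy aU uU ax).
  have [yz'|nyz] := boolP (adj y z).
    by left; apply: (spanned_two_paths yU zU xU yz yx zx uU aU uy).
  by right; apply: bad => //; left; rewrite (negPf nxy) (negPf nxz).
Qed.

End ThreeLeft.

(** Induction on the number of vertices outside [U]: either [U] grows, or the at most three
    remaining vertices are appended. *)
Lemma strong_spanned U : connected_graph G -> 14 <= #|G| ->
    \sum_(x : G) codeg setT x + 20 <= 6 * #|G| ->
    strong U -> 4 < #|U| ->
  spanned.
Proof.
move=> connG n14 dense.
have [k] := ubnP #|~: U|; elim: k U => // k IHk U Uk sU U5.
have cardU := cardsC U.
have grow V : strong V -> #|U| < #|V| -> spanned.
  by move=> sV UV; apply: (IHk V) => //; have := cardsC V; lia.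
have growx x : x \notin U -> strong (x |: U) -> spanned.
  by move=> xU sxU; apply: (grow _ sxU); rewrite cardsU1 xU.
have [/existsP[x /andP[xU x3]]|] :=
    boolP [exists x, (x \notin U) && (2 < deg U x)].
  exact/(growx x)/strong_add_deg3.
rewrite negb_exists => /forallP deg2.
have {}deg2 x : x \notin U -> deg U x <= 2.
  by move=> xU; have := deg2 x; rewrite xU /= -leqNgt.
have [/existsP[x /existsP[y /and5P[xU yU xy x1 y1]]]|] := boolP [exists x,
    exists y, [&& x \notin U, y \notin U, adj x y, 1 < deg U x & 1 < deg U y]].
  by have [V] := strong_grow_edge sU xU yU xy x1 (ltnW y1); apply: grow.
rewrite negb_exists => /forallP indep.
have k3 : #|~: U| <= 3.
  apply: outside_le3 => // x y xU yU xy x1 y1.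
  have := indep x; rewrite negb_exists => /forallP/(_ y).
  by rewrite xU yU xy x1 y1.
have [s sU'] : exists s, s \in U by apply/card_gt0P; lia.
have exit V : s \in V -> #|V| < #|G| ->
    exists u v, [/\ u \in V, v \notin V & adj u v].
  move=> sV VG; have /card_gt0P[t] : 0 < #|~: V| by rewrite cardsCs setCK; lia.
  by rewrite inE => tV; apply: (connected_exit connG sV tV).
have full V : #|G| <= #|V| -> V = setT.
  by move=> GV; apply/eqP; rewrite eqEcard subsetT cardsT.
have [k0|k0] := posnP #|~: U|.
  exists s, s; rewrite -(full U); last lia.
  exact: strong_traversable.
have [||a [x [aU xU ax]]] := exit U; first by []; first by lia.
have cxU : #|x |: U| = #|U| + 1 by rewrite cardsU1 xU addnC.
have [k1|k1] := eqVneq #|~: U| 1.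
  exists a, x; rewrite -(full (x |: U)); last lia.
  by apply: traversable_end ax => //; apply: strong_traversable.
have [k2|k2] := eqVneq #|~: U| 2.
  have [||u [y [uU yU uy]]] := exit (x |: U).
  - by rewrite inE sU' orbT.
  - by rewrite cxU; lia.
  have cyU : #|y |: (x |: U)| = #|U| + 2 by rewrite cardsU1 cxU yU; lia.
  move: uU; rewrite !inE => /orP[/eqP eu|uU].
    subst u; exists a, y; rewrite -(full (y |: (x |: U))); last lia.
    apply: traversable_end uy => //; apply: traversable_end ax => //.
    exact: strong_traversable.
  (* Both outer vertices are attached to [U]: [y] leads in and [x] leads out. *)
  exists y, x; rewrite -(full (y |: (x |: U))); last lia.
  apply: traversable_start uy => //; apply: traversable_end ax => //.
  exact: strong_traversable.
have k3' : #|~: U| = 3 by lia.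
have U0 : 0 < #|U| by exact: leq_trans U5.
have [//|[w wU [w1 sumU]]] := three_left sU k3' connG dense deg2 U0.
(* Here [#|U| = #|G| - 3 >= 11]. The bipartition of [U] is discarded and a new one built around
   [w]. *)
apply: (growx w wU); apply: strong_almost_complete => //; lia.
Qed.

End Spanning.

Unset Implicit Arguments.

Theorem theorem5p4 (n : nat) (G : sgraph) (hn : 14 <= n) (hG : #|G| = n)
  (hconn : connected_graph G)
  (hlow : 'C(n - 3, 2) + 4 <= #|edges G|)
  (hupp : #|edges G| <= 'C(n, 2) - 1) :
  is_pc G 2.
Proof.
subst n; have dense := sum_codeg_edges hn hlow.
have [a [b [ab Y3]]] := common_neighbours hn dense.
have [s [t st]] : spanned G.
  have sV : strong (a |: (b |: [set y | adj a y && adj b y])).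
    by apply: strong_K2 ab (ltnW Y3) _ => y; rewrite inE.
  apply: strong_spanned hconn hn dense sV _.
  by rewrite !cardsU1 !inE !adj_irrefl andbF negb_or ab.
have [/existsP[x /existsP[y /andP[xy nxy]]]|] :=
    boolP [exists x : G, exists y : G, (x != y) && ~~ adj x y].
  exact: traversable_pc2 xy nxy st.
rewrite negb_exists => /forallP complete.
have : 'C(#|G|, 2) <= #|edges G|.
  apply: edges_le_complete => x y xy; have := complete x.
  by rewrite negb_exists => /forallP/(_ y); rewrite xy negbK.
(* Subtraction is truncated, so positivity is required for [hupp] to contradict completeness. *)
have : 0 < 'C(#|G|, 2) by rewrite bin_gt0; lia.
lia.
Qed.
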